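(* Let $p$ be an odd prime, $q=p^f$ with $f\geq 1$, let $G=G(q)$ be the pro-$p$ group of infinite upper unitriangular matrices over $\mathbb{F}_q$, let $\mathcal{N}=\mathcal{N}_q$ be the Nottingham group over $\mathbb{F}_q$, and let $\sigma:\mathcal{N}\to G$ be the explicit embedding described in the context. Then $\sigma(\mathcal{N})$ is a closed subgroup of $G$ of infinite index in $G$. In particular, $\sigma(\mathcal{N})$ does not contain any nonempty open subset of $G$.
   Context: $\mathbb{N}$ denotes the positive integers. For $n\in\mathbb{N}$, $G_n(q)$ is the group of $n\times n$ upper triangular matrices over $\mathbb{F}_q$ with all diagonal entries $1$. The maps $G_{n+1}(q)\to G_n(q)$ deleting the last row and column form an inverse system of finite $p$-groups, and $G=G(q)=\varprojlim_n G_n(q)$ is the inverse limit with its profinite topology; its elements are the matrices $(x_{ij})_{i,j\in\mathbb{N}}$ over $\mathbb{F}_q$ with $x_{ii}=1$ and $x_{ij}=0$ for $i>j$. The kernels $N_n$ of $G\to G_n(q)$ form a base of open neighbourhoods of $1$. The Nottingham group $\mathcal{N}=\mathcal{N}_q$ is the group of $\mathbb{F}_q$-algebra automorphisms of $\mathbb{F}_q[[t]]$ of the form $t\mapsto t+\sum_{j\geq 2}a_jt^j$, $a_j\in\mathbb{F}_q$, acting on the right on $\mathbb{F}_q[[t]]$ (the image of $h$ under $u$ is written $hu$, and $h(uv)=(hu)v$). The map $\sigma:\mathcal{N}\to G$ sends $u\in\mathcal{N}$ to the matrix of its action: for $i,j\in\mathbb{N}$, $\sigma(u)_{ij}$ is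 the coefficient of $t^j$ in $(t^i)u=(tu)^i$. In particular, for $r\geq 1$ and $\alpha\in\mathbb{F}_q$, the element $e_r[\alpha]:t\mapsto t+\alpha t^{r+1}$ is sent to the matrix whose $(i,j)$ entry is $\binom{i}{(j-i)/r}\alpha^{(j-i)/r}$ when $j\geq i$ and $r\mid j-i$, and $0$ otherwise. *)

(* Defs.v *)
From HB Require Import structures.
From mathcomp Require Import all_boot all_order all_algebra.
From mathcomp Require Import boolp classical_sets functions cardinality filter.
From mathcomp Require Import topology.

Set Implicit Arguments.
Unset Strict Implicit.
Unset Printing Implicit Defensive.

Import GRing.Theory.

Local Open Scope ring_scope.

Section PowerSeries.
Context {F : fieldType}.

Record fps := Fps { coefs : nat -> F }.

HB.instance Definition _ := [isNew for coefs].
HB.instance Definition _ := [Choice of fps by <:].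

Lemma fpsP (a b : fps) : coefs a =1 coefs b -> a = b.
Proof. by case: a b => [a] [b] /= /funext ->. Qed.

Definition fps_zero := Fps (fun=> 0).
Definition fps_opp (a : fps) := Fps (fun n => - coefs a n).
Definition fps_add (a b : fps) := Fps (fun n => coefs a n + coefs b n).

Fact fps_addA : associative fps_add.
Proof. by move=> a b c; apply: fpsP => n /=; rewrite addrA. Qed.
Fact fps_addC : commutative fps_add.
Proof. by move=> a b; apply: fpsP => n /=; rewrite addrC. Qed.
Fact fps_add0 : left_id fps_zero fps_add.
Proof. by move=> a; apply: fpsP => n /=; rewrite add0r. Qed.
Fact fps_addN : left_inverse fps_zero fps_opp fps_add.
Proof. by move=> a; apply: fpsP => n /=; rewrite addNr. Qed.

HB.instance Definition _ :=
  GRing.isZmodule.Build fps fps_addA fps_addC fps_add0 fps_addN.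

Definition fps_one := Fps (fun n => (n == 0)%:R).
Definition fps_mul (a b : fps) :=
  Fps (fun n => \sum_(i < n.+1) coefs a i * coefs b (n - i)).

Let trunc m (a : fps) : {poly F} := \poly_(i < m) coefs a i.

Let truncE m a i : (i < m)%N -> (trunc m a)`_i = coefs a i.
Proof. by move=> im; rewrite coef_poly im. Qed.

Let coef_fps_mul n (p r : {poly F}) (a b : fps) :
    (forall i, (i <= n)%N -> p`_i = coefs a i) ->
    (forall i, (i <= n)%N -> r`_i = coefs b i) ->
  forall i, (i <= n)%N -> (p * r)`_i = coefs (fps_mul a b) i.
Proof.
move=> pa rb i le_in; rewrite coefM; apply: eq_bigr => k _.
by rewrite pa ?rb // (leq_trans _ le_in) ?leq_subr // -ltnS.
Qed.

Let trunc_le n a i : (i <= n)%N -> (trunc n.+1 a)`_i = coefs a i.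
Proof. by move=> ?; rewrite truncE. Qed.

Fact fps_mulA : associative fps_mul.
Proof.
move=> a b c; apply: fpsP => n.
have H x := @trunc_le n x.
rewrite -(coef_fps_mul (H a) (coef_fps_mul (H b) (H c))) //.
by rewrite mulrA; apply: (coef_fps_mul (coef_fps_mul (H a) (H b)) (H c)).
Qed.

Fact fps_mulC : commutative fps_mul.
Proof.
move=> a b; apply: fpsP => n; have H x := @trunc_le n x.
by rewrite -(coef_fps_mul (H a) (H b)) // mulrC; apply: (coef_fps_mul (H b) (H a)).
Qed.

Fact fps_mul1 : left_id fps_one fps_mul.
Proof.
move=> a; apply: fpsP => n /=.
rewrite big_ord_recl /= mul1r subn0 big1 ?addr0 // => i _.
by rewrite mul0r.
Qed.

Fact fps_mulDl : left_distributive fps_mul fps_add.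
Proof.
move=> a b c; apply: fpsP => n /=; rewrite -big_split /=.
by apply: eq_bigr => i _; rewrite mulrDl.
Qed.

Fact fps_one_neq0 : fps_one != 0 :> fps.
Proof.
by apply/eqP => /(congr1 (coefs ^~ 0)) /eqP /=; rewrite oner_eq0.
Qed.

HB.instance Definition _ := GRing.Zmodule_isComNzRing.Build fps
  fps_mulA fps_mulC fps_mul1 fps_mulDl fps_one_neq0.

Definition fps_scale (c : F) (a : fps) := Fps (fun n => c * coefs a n).

Fact fps_scaleA c d a : fps_scale c (fps_scale d a) = fps_scale (c * d) a.
Proof. by apply: fpsP => n /=; rewrite mulrA. Qed.
Fact fps_scale1 : left_id 1 fps_scale.
Proof. by move=> a; apply: fpsP => n /=; rewrite mul1r. Qed.
Fact fps_scaleDr : right_distributive fps_scale +%R.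
Proof. by move=> c a b; apply: fpsP => n /=; rewrite mulrDr. Qed.
Fact fps_scaleDl a : {morph fps_scale^~ a : c d / c + d}.
Proof. by move=> c d; apply: fpsP => n /=; rewrite mulrDl. Qed.

HB.instance Definition _ := GRing.Zmodule_isLmodule.Build F fps
  fps_scaleA fps_scale1 fps_scaleDr fps_scaleDl.

Fact fps_scaleAl (c : F) (a b : fps) : c *: (a * b) = (c *: a) * b.
Proof.
apply: fpsP => n /=; rewrite big_distrr /=.
by apply: eq_bigr => i _; rewrite mulrA.
Qed.

HB.instance Definition _ := GRing.Lmodule_isLalgebra.Build F fps fps_scaleAl.
HB.instance Definition _ := GRing.Lalgebra_isComAlgebra.Build F fps.

Definition fpsX : fps := Fps (fun n => (n == 1)%:R).

Lemma coefs0 n : coefs 0 n = 0. Proof. by []. Qed.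
Lemma coefs1 n : coefs 1 n = (n == 0)%:R. Proof. by []. Qed.
Lemma coefsD a b n : coefs (a + b) n = coefs a n + coefs b n.
Proof. by []. Qed.
Lemma coefsZ (c : F) (a : fps) n : coefs (c *: a) n = c * coefs a n.
Proof. by []. Qed.
Lemma coefsM a b n :
  coefs (a * b) n = \sum_(i < n.+1) coefs a i * coefs b (n - i).
Proof. by []. Qed.

Lemma coefs0M a b : coefs (a * b) 0 = coefs a 0 * coefs b 0.
Proof. by rewrite coefsM big_ord1. Qed.

Lemma coefsXM a n : coefs (fpsX * a) n = if n is n'.+1 then coefs a n' else 0.
Proof.
rewrite coefsM; case: n => [|n]; first by rewrite big_ord1 mul0r.
rewrite !big_ord_recl /= mul0r add0r mul1r subSS subn0 big1 ?addr0 // => i _.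
by rewrite mul0r.
Qed.

Lemma coefsXnM a i n :
  coefs (fpsX ^+ i * a) n = if (n < i)%N then 0 else coefs a (n - i).
Proof.
elim: i n => [|i IHi] n; first by rewrite expr0 mul1r subn0.
by rewrite exprS -mulrA coefsXM; case: n => [//|n]; rewrite IHi.
Qed.

Lemma coefs0_exp a n : coefs (a ^+ n) 0 = coefs a 0 ^+ n.
Proof. by elim: n => [|n IHn] //; rewrite !exprS coefs0M IHn. Qed.

Lemma fps_divX (a : fps) : exists b, a = (coefs a 0)%:A + fpsX * b.
Proof.
exists (Fps (fun n => coefs a n.+1)); apply: fpsP => n.
rewrite coefsD coefsZ coefsXM coefs1; case: n => [|n] /=.
  by rewrite mulr1 addr0.
by rewrite mulr0 add0r.
Qed.

End PowerSeries.

Arguments fps : clear implicits.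
Arguments fpsX {F}.

Section Nottingham.
Context {F : fieldType}.

Definition nottingham_aut (u : fps F -> fps F) : Prop :=
  [/\ linear u, GRing.monoid_morphism u, bijective u &
      coefs (u fpsX) 0 = 0 /\ coefs (u fpsX) 1 = 1].

Record nottingham :=
  Nottingham { naut :> fps F -> fps F; _ : `[< nottingham_aut naut >] }.

HB.instance Definition _ := [isSub for naut].
HB.instance Definition _ := [Choice of nottingham by <:].

Lemma nottinghamP (u : nottingham) : nottingham_aut u.
Proof. by case: u => u /= /asboolP. Qed.

Lemma eq_nottingham (u v : nottingham) : u =1 v -> u = v.
Proof. by move=> /funext uv; apply: val_inj. Qed.

Definition mkNottingham (u : fps F -> fps F) (hu : nottingham_aut u) :=
  Nottingham (introT (asboolP _) hu).

Fact nottingham_id : nottingham_aut id.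
Proof. by split=> //; exists id. Qed.

Let autD u : nottingham_aut u -> {morph u : a b / a + b}.
Proof. by case=> ul _ _ _ a b; rewrite -[a]scale1r ul !scale1r. Qed.

Let autA u c : nottingham_aut u -> u c%:A = c%:A.
Proof.
move=> [ul [u1 _] _ _]; have u0 : u 0 = 0.
  by have := ul (-1) 0 0; rewrite scaleN1r oppr0 addr0 scaleN1r addNr.
by rewrite -[c%:A]addr0 ul u0 u1.
Qed.

Let autX u g : nottingham_aut u ->
  coefs (u (fpsX * g)) 0 = 0 /\ coefs (u (fpsX * g)) 1 = coefs (u g) 0.
Proof.
move=> [_ [_ uM] _ [u0 u1]]; rewrite uM coefs0M u0 mul0r; split=> //.
by rewrite coefsM !big_ord_recl big_ord0 u0 u1 mul0r add0r mul1r addr0.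
Qed.

Let aut0 u a : nottingham_aut u -> coefs (u a) 0 = coefs a 0.
Proof.
move=> uP; have [b ab] := fps_divX a.
rewrite {1}ab (autD uP) (autA _ uP) coefsD (autX _ uP).1 addr0.
by rewrite coefsZ coefs1 mulr1.
Qed.

Fact nottingham_comp u v :
  nottingham_aut u -> nottingham_aut v -> nottingham_aut (v \o u).
Proof.
move=> uP vP; have [ul [u1 uM] ubij [uX0 uX1]] := uP.
have [vl [v1 vM] vbij [vX0 vX1]] := vP.
split.
- by move=> c a b /=; rewrite ul vl.
- by split=> [|a b] /=; rewrite ?u1 ?uM.
- exact: bij_comp.
have [w uXE] := fps_divX (u fpsX).
rewrite uX0 scale0r add0r in uXE.
rewrite /= uXE (autX _ vP).1 (autX _ vP).2 (aut0 _ vP); split=> //.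
by move: uX1; rewrite uXE coefsXM.
Qed.

Definition naut_inv (u : nottingham) : fps F -> fps F :=
  let: And4 _ _ ubij _ := nottinghamP u in
  sval (cid (let: Bijective v uK vK := ubij in
             ex_intro (fun v => cancel u v /\ cancel v u) v (conj uK vK))).

Lemma naut_invP (u : nottingham) : cancel u (naut_inv u) /\ cancel (naut_inv u) u.
Proof. by rewrite /naut_inv; case: (nottinghamP u) => ? ? ? ?; case: cid. Qed.

Fact nottingham_inv (u : nottingham) : nottingham_aut (naut_inv u).
Proof.
have [uK vK] := naut_invP u; have uP := nottinghamP u.
set v := naut_inv u in uK vK *.
have [ul [u1 uM] _ _] := uP; have uI := can_inj uK.
split.
- by move=> c a b; apply: uI; rewrite ul !vK.
- by split=> [|a b]; apply: uI; rewrite ?uM !vK ?u1.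
- by exists u.
have v0 a : coefs (v a) 0 = coefs a 0 by rewrite -(aut0 _ uP) vK.
have v00 : coefs (v fpsX) 0 = 0 by rewrite v0.
split=> //; have [g vXE] := fps_divX (v fpsX).
rewrite v00 scale0r add0r in vXE.
rewrite vXE coefsXM -(aut0 _ uP) -(autX _ uP).2 -vXE vK.
by [].
Qed.

Definition nottingham_one := mkNottingham nottingham_id.
(* Automorphisms act on the right: [u * v] applies [u] first. *)
Definition nottingham_mul (u v : nottingham) :=
  mkNottingham (nottingham_comp (nottinghamP u) (nottinghamP v)).
Definition nottingham_invg (u : nottingham) :=
  mkNottingham (nottingham_inv u).

Fact nottingham_mulA : associative nottingham_mul.
Proof. by move=> u v w; apply: eq_nottingham. Qed.
Fact nottingham_mul1 : left_id nottingham_one nottingham_mul.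
Proof. by move=> u; apply: eq_nottingham. Qed.
Fact nottingham_1mul : right_id nottingham_one nottingham_mul.
Proof. by move=> u; apply: eq_nottingham. Qed.
Fact nottingham_mulV :
  left_inverse nottingham_one nottingham_invg nottingham_mul.
Proof. by move=> u; apply: eq_nottingham => a /=; rewrite (naut_invP u).2. Qed.
Fact nottingham_Vmul :
  right_inverse nottingham_one nottingham_invg nottingham_mul.
Proof. by move=> u; apply: eq_nottingham => a /=; rewrite (naut_invP u).1. Qed.

HB.instance Definition _ := isGroup.Build nottingham
  nottingham_mulA nottingham_mul1 nottingham_1mul
  nottingham_mulV nottingham_Vmul.

End Nottingham.

Arguments nottingham : clear implicits.

(* Rows and columns are numbered from 0, so that [x i j] is the entry in
   position (i + 1, j + 1) in the numbering by positive integers. *)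

Section Unitriangular.
Context {F : fieldType}.

Definition unitriangular (x : nat -> nat -> F) : Prop :=
  (forall i, x i i = 1) /\ (forall i j, (j < i)%N -> x i j = 0).

Record unitri :=
  Unitri { unitri_fun :> nat -> nat -> F; _ : `[< unitriangular unitri_fun >] }.

HB.instance Definition _ := [isSub for unitri_fun].
HB.instance Definition _ := [Choice of unitri by <:].

Lemma unitriP (x : unitri) : unitriangular x.
Proof. by case: x => x /= /asboolP. Qed.

Lemma eq_unitri (x y : unitri) : (forall i j, x i j = y i j) -> x = y.
Proof.
by move=> xy; apply: val_inj; apply/funext => i; apply/funext => j; apply: xy.
Qed.

Definition mkUnitri (x : nat -> nat -> F) (hx : unitriangular x) :=
  Unitri (introT (asboolP _) hx).

Definition trunc n (x : unitri) : 'M[F]_n := \matrix_(i, j) x i j.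

Fact unitri_one_subproof : unitriangular (fun i j => (i == j)%:R).
Proof.
by split=> [i|i j ltji] /=; rewrite ?eqxx // gtn_eqF.
Qed.

Definition unitri_one := mkUnitri unitri_one_subproof.

(* The terms of the matrix product with index [k > j] vanish. *)
Fact unitri_mul_subproof (x y : unitri) :
  unitriangular (fun i j => \sum_(k < j.+1) x i k * y k j).
Proof.
have [[x1 x0] [y1 y0]] := (unitriP x, unitriP y).
split=> [i|i j ltji] /=.
  rewrite big_ord_recr /= x1 y1 mul1r big1 ?add0r // => k _.
  by rewrite x0 ?mul0r.
by rewrite big1 // => k _; rewrite x0 ?mul0r // (leq_trans _ ltji).
Qed.

Definition unitri_mul (x y : unitri) := mkUnitri (unitri_mul_subproof x y).

Lemma unitri_mulE (x y : unitri) n i j : (j < n)%N ->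
  unitri_mul x y i j = \sum_(k < n) x i k * y k j.
Proof.
move=> ltjn /=; rewrite (big_ord_widen _ (fun k => x i k * y k j) ltjn).
rewrite big_mkcond; apply: eq_bigr => k _; case: ifPn => //.
by rewrite -leqNgt => ltjk; rewrite (unitriP y).2 ?mulr0.
Qed.

Lemma trunc_mul n x y : trunc n (unitri_mul x y) = trunc n x *m trunc n y.
Proof.
apply/matrixP => i j; rewrite !mxE (unitri_mulE _ _ _ (ltn_ord j)).
by apply: eq_bigr => k _; rewrite !mxE.
Qed.

Lemma trunc_one n : trunc n unitri_one = 1%:M.
Proof. by apply/matrixP => i j; rewrite !mxE. Qed.

Lemma trunc_inj x y : (forall n, trunc n x = trunc n y) -> x = y.
Proof.
move=> xy; apply: eq_unitri => i j.
have lei : (i < (maxn i j).+1)%N by rewrite ltnS leq_maxl.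
have lej : (j < (maxn i j).+1)%N by rewrite ltnS leq_maxr.
by have /matrixP/(_ (Ordinal lei) (Ordinal lej)) := xy (maxn i j).+1; rewrite !mxE.
Qed.

Lemma trunc_unitmx n x : trunc n x \in unitmx.
Proof.
have [x1 x0] := unitriP x.
rewrite unitmxE -det_tr det_trig.
  by rewrite big1 ?unitr1 // => i _; rewrite !mxE x1.
by apply/is_trig_mxP => i j ltij; rewrite !mxE x0.
Qed.

(* The [j]-th column of the inverse is that of the inverse of any
   truncation of size greater than [j]. *)
Definition unitri_inv_fun (x : unitri) i j : F :=
  if (i <= j)%N then invmx (trunc j.+1 x) (inord i) ord_max else 0.

Lemma unitri_mul_inv_fun (x : unitri) i j :
  \sum_(k < j.+1) x i k * unitri_inv_fun x k j = (i == j)%:R.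
Proof.
case: (leqP i j) => [leij|ltji]; last first.
  rewrite gtn_eqF // big1 // => k _.
  by rewrite (unitriP x).2 ?mul0r // (leq_trans _ ltji).
have /matrixP/(_ (inord i) ord_max) := mulmxV (trunc_unitmx j.+1 x).
rewrite !mxE -val_eqE /= inordK // => <-; apply: eq_bigr => k _.
by rewrite !mxE inordK // /unitri_inv_fun -ltnS ltn_ord inord_val.
Qed.

Fact unitri_inv_subproof x : unitriangular (unitri_inv_fun x).
Proof.
split=> [i|i j ltji]; last by rewrite /unitri_inv_fun leqNgt ltji.
have := unitri_mul_inv_fun x i i; rewrite eqxx big_ord_recr /=.
rewrite (unitriP x).1 mul1r big1 ?add0r // => k _.
by rewrite (unitriP x).2 ?mul0r.
Qed.

Definition unitri_inv x := mkUnitri (unitri_inv_subproof x).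

Fact unitri_mulA : associative unitri_mul.
Proof.
by move=> x y z; apply: trunc_inj => n; rewrite !trunc_mul mulmxA.
Qed.
Fact unitri_mul1 : left_id unitri_one unitri_mul.
Proof. by move=> x; apply: trunc_inj => n; rewrite trunc_mul trunc_one mul1mx. Qed.
Fact unitri_1mul : right_id unitri_one unitri_mul.
Proof. by move=> x; apply: trunc_inj => n; rewrite trunc_mul trunc_one mulmx1. Qed.
Fact unitri_Vmul : right_inverse unitri_one unitri_inv unitri_mul.
Proof. by move=> x; apply: eq_unitri => i j; apply: unitri_mul_inv_fun. Qed.
Fact unitri_mulV : left_inverse unitri_one unitri_inv unitri_mul.
Proof.
move=> x; apply: trunc_inj => n; rewrite trunc_mul trunc_one.
by apply: mulmx1C; rewrite -trunc_mul unitri_Vmul trunc_one.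
Qed.

HB.instance Definition _ := isGroup.Build unitri
  unitri_mulA unitri_mul1 unitri_1mul unitri_mulV unitri_Vmul.

Local Open Scope classical_set_scope.

Definition trunc_ker n : set unitri := [set x | trunc n x = 1%:M].

Definition unitri_nbhs (x : unitri) : set_system unitri :=
  filter_from [set: nat] (fun n => [set (x * y)%g | y in trunc_ker n]).

HB.instance Definition _ := hasNbhs.Build unitri unitri_nbhs.

Lemma trunc_kerP n (x y : unitri) :
  [set (x * z)%g | z in trunc_ker n] y <-> trunc n y = trunc n x.
Proof.
split=> [[z zn <-]|yx]; first by rewrite trunc_mul zn mulmx1.
exists (x^-1 * y)%g; last by rewrite mulVKg.
by rewrite /trunc_ker /= trunc_mul yx -trunc_mul unitri_mulV trunc_one.
Qed.

Lemma trunc_le m n (x y : unitri) :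
  (m <= n)%N -> trunc n x = trunc n y -> trunc m x = trunc m y.
Proof.
move=> lemn /matrixP xy; apply/matrixP => i j.
by have := xy (widen_ord lemn i) (widen_ord lemn j); rewrite !mxE.
Qed.

Fact unitri_nbhs_filter (x : unitri) : ProperFilter (nbhs x).
Proof.
apply: filter_from_proper => [|n _]; last by exists x; apply/trunc_kerP.
apply: filter_from_filter => [|m n _ _]; first by exists 0.
exists (maxn m n) => // y /trunc_kerP yx; split; apply/trunc_kerP.
  exact: trunc_le (leq_maxl m n) yx.
exact: trunc_le (leq_maxr m n) yx.
Qed.

Fact unitri_nbhs_singleton (x : unitri) (A : set unitri) : nbhs x A -> A x.
Proof. by case=> n _; apply; apply/trunc_kerP. Qed.

Fact unitri_nbhs_nbhs (x : unitri) (A : set unitri) :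
  nbhs x A -> nbhs x (nbhs^~ A).
Proof.
case=> n _ xA; exists n => // y /trunc_kerP yx; exists n => // z /trunc_kerP zy.
by apply/xA/trunc_kerP; rewrite zy.
Qed.

HB.instance Definition _ := Nbhs_isNbhsTopological.Build unitri
  unitri_nbhs_filter unitri_nbhs_singleton unitri_nbhs_nbhs.

End Unitriangular.

Arguments unitri : clear implicits.

Section Sigma.
Context {F : fieldType}.

Fact sigma_subproof (u : nottingham F) :
  unitriangular (fun i j => coefs (u (fpsX ^+ i.+1)) j.+1).
Proof.
have [_ [u1 uM] _ [uX0 uX1]] := nottinghamP u.
have uXn n : u (fpsX ^+ n) = u fpsX ^+ n.
  by elim: n => [|n IHn]; rewrite ?u1 // !exprS uM IHn.
have [w uXE] := fps_divX (u fpsX); rewrite uX0 scale0r add0r in uXE.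
have w0 : coefs w 0 = 1 by rewrite -uX1 uXE coefsXM.
split=> [i|i j ltji]; rewrite uXn uXE exprMn coefsXnM.
  by rewrite ltnn subnn coefs0_exp w0 expr1n.
by rewrite ltnS ltji.
Qed.

Definition sigma (u : nottingham F) : unitri F := mkUnitri (sigma_subproof u).

End Sigma.

Definition right_cosets (G : groupType) (H : set G) : set (set G) :=
  [set [set (h * g)%g | h in H] | g in [set: G]]%classic.

Definition infinite_index (G : groupType) (H : set G) : Prop :=
  infinite_set (right_cosets H).

(* Main.v *)
(* Infinite matrices act on power series on the right, fixing constants, and an
   element of [G] lies in [sigma(N)] exactly when its action is multiplicative.
   This condition is preserved by products and inverses, and each of its
   coefficients involves finitely many entries of the matrix, so [sigma(N)] is a
   closed subgroup.  A multiplicative action is determined by the image of [t],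
   i.e. by the first row of the matrix; hence [sigma(N)] meets trivially the
   subgroup of matrices whose first row is that of the identity.  That subgroup
   is infinite, so the index is infinite, and it meets every [N_n] nontrivially,
   so [sigma(N)] contains no [N_n]. *)
Require Import Defs.
From HB Require Import structures.
From mathcomp Require Import all_boot all_order all_algebra.
From mathcomp Require Import boolp classical_sets functions cardinality filter.
From mathcomp Require Import topology.

Local Open Scope classical_set_scope.

Import GRing.Theory.

Set Implicit Arguments.
Unset Strict Implicit.
Unset Printing Implicit Defensive.

Section RowAction.
Context {F : fieldType}.
Implicit Types (a b : fps F) (x y : unitri F) (u : nottingham F).
Local Open Scope ring_scope.

(** * The action of unitriangular matrices on power series *)

Lemma coefsXn i n : coefs (fpsX ^+ i : fps F) n = (n == i)%:R.
Proof.
rewrite -[_ ^+ _]mulr1 coefsXnM coefs1 subn_eq0.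
by case: (ltngtP n i).
Qed.

(** Reduces coefficients below [n] of a linear map preserving the ideal of [fpsX ^+ n] to its values
    on powers of [fpsX]. *)
Lemma fps_divXn n a :
  exists b, a = \sum_(k < n) coefs a k *: fpsX ^+ k + fpsX ^+ n * b.
Proof.
elim: n => [|n [b aE]]; first by exists a; rewrite big_ord0 add0r mul1r.
have [c bE] := fps_divX b; exists c.
have an : coefs a n = coefs b 0.
  rewrite {1}aE coefsD coefsXnM ltnn subnn.
  suff -> : coefs (\sum_(k < n) coefs a k *: fpsX ^+ k) n = 0 by rewrite add0r.
  elim/big_ind: _ => [//|f g f0 g0|i _]; first by rewrite coefsD f0 g0 addr0.
  by rewrite coefsZ coefsXn gtn_eqF ?mulr0.
rewrite big_ord_recr /= an {1}aE -addrA; congr (_ + _).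
by rewrite {1}bE mulrDr -scalerAr mulr1 mulrA -exprSr.
Qed.

(* Right multiplication of the row vector [(coefs a 1, coefs a 2, ..)] by [x]. *)
Definition act x a : fps F :=
  Fps (fun n => if n is j.+1 then \sum_(k < j.+1) coefs a k.+1 * x k j
                else coefs a 0).

Lemma coefs_actS x a n j : (j < n)%N ->
  coefs (act x a) j.+1 = \sum_(k < n) coefs a k.+1 * x k j.
Proof.
move=> ltjn; rewrite /= (big_ord_widen _ (fun k => coefs a k.+1 * x k j) ltjn).
rewrite big_mkcond; apply: eq_bigr => k _; case: ifPn => //.
by rewrite -leqNgt => ltjk; rewrite (unitriP x).2 ?mulr0.
Qed.

Lemma act_linear x : linear (act x).
Proof.
move=> c a b; apply: fpsP => -[//|j] /=.
rewrite mulr_sumr -big_split; apply: eq_bigr => k _ /=.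
by rewrite mulrDl mulrA.
Qed.

Lemma act_one a : act 1%g a = a.
Proof.
apply: fpsP => -[//|j] /=.
rewrite big_ord_recr /= eqxx mulr1 big1 ?add0r // => k _.
by rewrite ltn_eqF ?mulr0.
Qed.

Lemma act_mul x y a : act (x * y)%g a = act y (act x a).
Proof.
apply: fpsP => -[//|j].
rewrite -[RHS]/(\sum_(k < j.+1) coefs (act x a) k.+1 * y k j).
(* Extending the inner sums to the common range [j.+1] only adds zero terms and lets them be
   exchanged. *)
under [RHS]eq_bigr => k _ do rewrite (coefs_actS _ _ (ltn_ord k)) mulr_suml.
rewrite exchange_big /=; apply: eq_bigr => l _.
by rewrite mulr_sumr; apply: eq_bigr => k _; rewrite mulrA.
Qed.

Lemma actK x : cancel (act x) (act x^-1%g).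
Proof. by move=> a; rewrite -act_mul mulgV act_one. Qed.

Lemma actVK x : cancel (act x^-1%g) (act x).
Proof. by move=> a; rewrite -act_mul mulVg act_one. Qed.

Lemma act1 x : act x 1 = 1.
Proof. by apply: fpsP => -[//|j] /=; rewrite big1 // => k _; rewrite mul0r. Qed.

Lemma coefs_actXn x i j : coefs (act x (fpsX ^+ i.+1)) j.+1 = x i j.
Proof.
rewrite (@coefs_actS _ _ (maxn i j).+1) ?ltnS ?leq_maxr //.
have lti : (i < (maxn i j).+1)%N by rewrite ltnS leq_maxl.
rewrite (bigD1 (Ordinal lti)) //= coefsXn eqxx mul1r big1 ?addr0 // => k nki.
by rewrite coefsXn eqSS -[i]/(val (Ordinal lti)) val_eqE (negbTE nki) mul0r.
Qed.

Lemma coefs_act_trunc n x y a m : trunc n x = trunc n y -> (m <= n)%N ->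
  coefs (act x a) m = coefs (act y a) m.
Proof.
move=> /matrixP xy; case: m => [//|j] ltjn; rewrite !(coefs_actS _ _ ltjn).
by apply: eq_bigr => k _; have := xy k (Ordinal ltjn); rewrite !mxE => ->.
Qed.

(** The t-adic continuity of [u], derived from algebra alone: [u fpsX] is divisible by [fpsX], and
    [u] is multiplicative. *)
Lemma coefs_naut_XnM u n a m : (m < n)%N -> coefs (u (fpsX ^+ n * a)) m = 0.
Proof.
have [_ [u1 uM] _ [u0 _]] := nottinghamP u.
have [w uXE] := fps_divX (u fpsX); rewrite u0 scale0r add0r in uXE.
have uXn : u (fpsX ^+ n) = u fpsX ^+ n.
  by elim: n => [|n IHn]; rewrite ?u1 // !exprS uM IHn.
by move=> ltmn; rewrite uM uXn uXE exprMn -mulrA coefsXnM ltmn.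
Qed.

Lemma act_sigma u : act (sigma u) =1 u.
Proof.
move=> a; apply: fpsP => n; have [ul [u1 _] _ _] := nottinghamP u.
pose U : {linear fps F -> fps F} :=
  HB.pack (naut u) (GRing.isLinear.Build _ _ _ _ _ ul).
pose V : {linear fps F -> fps F} :=
  HB.pack (act (sigma u)) (GRing.isLinear.Build _ _ _ _ _ (act_linear (sigma u))).
have [b ->] := fps_divXn n.+1 a.
rewrite -[LHS]/(coefs (V _) n) -[RHS]/(coefs (U _) n) !raddfD !coefsD.
rewrite [coefs (U (_ ^+ _ * _)) n]coefs_naut_XnM //.
congr (_ + _); last first.
  case: n b => [|j] b; first exact: coefsXnM.
  by apply: big1 => k _; rewrite coefsXnM ltnS ltn_ord mul0r.
congr (coefs _ n); rewrite !raddf_sum; apply: eq_bigr => k _.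
rewrite [LHS](linearZZ V) [RHS](linearZZ U); congr (_ *: _).
rewrite -[LHS]/(act _ _) -[RHS]/(u _).
(* Row [i] encodes the image of [fpsX ^+ i.+1], so the constant power is treated apart. *)
case: (nat_of_ord k) => [|i]; first by rewrite expr0 u1 act1.
apply: fpsP => -[|j]; last exact: coefs_actXn.
by rewrite -[fpsX ^+ _]mulr1 coefs_naut_XnM // [LHS]coefsXnM.
Qed.

Lemma sigmaP x :
  range (@sigma F) x <-> {morph act x : a b / (a * b)%R >-> (a * b)%R}.
Proof.
split=> [[u _ <-] a b|xM].
  by rewrite !act_sigma; have [_ [_ ->] _ _] := nottinghamP u.
have xN : nottingham_aut (act x).
  split; [exact: act_linear|by split; [exact: act1|exact: xM]| |split].
  - by exists (act x^-1%g); [exact: actK|exact: actVK].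
  - by [].
  - by rewrite -[fpsX]expr1 coefs_actXn (unitriP x).1.
by exists (mkNottingham xN) => //; apply: eq_unitri => i j; apply: coefs_actXn.
Qed.

(** * The image as a closed subgroup *)

Lemma range_sigma1 : range (@sigma F) 1%g.
Proof. by apply/sigmaP => a b; rewrite !act_one. Qed.

Lemma range_sigmaM x y :
  range (@sigma F) x -> range (@sigma F) y -> range (@sigma F) (x * y)%g.
Proof.
by move=> /sigmaP xM /sigmaP yM; apply/sigmaP => a b; rewrite !act_mul xM yM.
Qed.

Lemma range_sigmaV x : range (@sigma F) x -> range (@sigma F) x^-1%g.
Proof.
move=> /sigmaP xM; apply/sigmaP => a b; apply: (can_inj (actK x)).
by rewrite xM !actVK.
Qed.

Lemma closed_range_sigma : closed (range (@sigma F)).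
Proof.
move=> x clx; apply/sigmaP => a b; apply: fpsP => n.
(* Agreement of [y] with [x] up to size [n] fixes all coefficients of index at most [n], hence both
   sides of the identity. *)
have [|y [/sigmaP yM /trunc_kerP yx]] := clx [set (x * z)%g | z in trunc_ker n].
  by exists n.
rewrite -(coefs_act_trunc _ yx) // yM !coefsM.
apply: eq_bigr => i _.
by rewrite !(coefs_act_trunc _ yx) ?leq_subr // -ltnS.
Qed.

(** * Infinite index and empty interior *)

(** The stabilizer of [fpsX] under [act]. *)
Definition first_row_trivial x := forall j, x 0 j = (j == 0)%:R.

Lemma first_row_trivialE x y j : first_row_trivial x -> (x * y)%g 0 j = y 0 j.
Proof.
move=> x0; rewrite /= big_ord_recl /= x0 mul1r big1 ?addr0 // => k _.
by rewrite x0 mul0r.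
Qed.

Lemma first_row_trivialM x y :
  first_row_trivial x -> first_row_trivial y -> first_row_trivial (x * y)%g.
Proof. by move=> x0 y0 j; rewrite first_row_trivialE. Qed.

Lemma first_row_trivialV x : first_row_trivial x -> first_row_trivial x^-1%g.
Proof. by move=> x0 j; rewrite -(first_row_trivialE _ _ x0) mulgV /= eq_sym. Qed.

Lemma range_sigma_first_row x :
  range (@sigma F) x -> first_row_trivial x -> x = 1%g.
Proof.
move=> /sigmaP xM x0.
have xX : act x fpsX = fpsX.
  apply: fpsP => -[//|j].
  by rewrite -{1}[fpsX]expr1 coefs_actXn x0.
have xXn n : act x (fpsX ^+ n) = fpsX ^+ n.
  by elim: n => [|n IHn]; rewrite ?act1 // !exprS xM IHn xX.
by apply: eq_unitri => i j; rewrite -coefs_actXn xXn coefsXn eqSS eq_sym.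
Qed.

(** Row 1 leaves row 0 untouched; column [n.+2] lies right of the diagonal and outside the
    truncation of size [n]. *)
Fact row1_elem_subproof n :
  unitriangular (fun i j => ((i == j) || (i == 1) && (j == n.+2))%:R : F).
Proof.
split=> [i|i j ltji]; first by rewrite eqxx.
by rewrite gtn_eqF //=; case: eqP ltji => [-> | //]; case: j.
Qed.

(* The matrix [1 + E_{1,n+2}], with rows and columns numbered from 0. *)
Definition row1_elem n := mkUnitri (row1_elem_subproof n).

Lemma row1_elem_first_row n : first_row_trivial (row1_elem n).
Proof. by move=> j; rewrite /= orbF eq_sym. Qed.

Lemma row1_elem_inj : injective row1_elem.
Proof.
move=> m n mn; have /eqP : row1_elem m 1 m.+2 = row1_elem n 1 m.+2 by rewrite mn.
by rewrite /= eqxx !eqSS; case: (eqVneq m n) => // _; rewrite oner_eq0.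
Qed.

Lemma row1_elem_neq1 n : row1_elem n <> 1%g.
Proof.
move=> n1; have /eqP : row1_elem n 1 n.+2 = (1%g : unitri F) 1 n.+2 by rewrite n1.
by rewrite /= eqxx oner_eq0.
Qed.

Lemma row1_elem_ker n : trunc_ker n (row1_elem n).
Proof.
apply/matrixP => i j; rewrite !mxE /= -val_eqE /=.
by rewrite [_ == n.+2]ltn_eqF ?andbF ?orbF // !leqW.
Qed.

Lemma infinite_index_range_sigma : infinite_index (range (@sigma F)).
Proof.
pose coset n := [set (h * row1_elem n)%g | h in range (@sigma F)].
have coset_inj : injective coset.
  move=> m n mn; apply: row1_elem_inj.
  have : coset m (row1_elem m) by exists 1%g; [exact: range_sigma1|rewrite mul1g].
  rewrite mn => -[h hs hE]; suff h1 : h = 1%g by rewrite -hE h1 mul1g.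
  (* Here [h] is the quotient of [row1_elem m] by [row1_elem n], both in the stabilizer. *)
  apply: range_sigma_first_row => //; rewrite -(mulgK (row1_elem n) h) hE.
  apply: first_row_trivialM; first exact: row1_elem_first_row.
  exact/first_row_trivialV/row1_elem_first_row.
move=> fin; apply: infinite_nat.
suff -> : [set: nat] = coset @^-1` right_cosets (range (@sigma F)).
  by apply: finite_preimage => // m n _ _; apply: coset_inj.
by apply/seteqP; split=> // n _; exists (row1_elem n).
Qed.

Lemma range_sigma_no_open (U : set (unitri F)) :
  open U -> U !=set0 -> ~ (U `<=` range (@sigma F)).
Proof.
move=> oU [x Ux] Us; have [n _ xU] : nbhs x U by rewrite openE in oU; exact: oU.
apply: (@row1_elem_neq1 n); apply: range_sigma_first_row; last first.
  exact: row1_elem_first_row.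
(* Both [x] and [x * row1_elem n] lie in [U], hence in the subgroup, and so does their quotient. *)
rewrite -(mulKg x (row1_elem n)); apply: range_sigmaM.
  exact/range_sigmaV/Us.
by apply/Us/xU; exists (row1_elem n) => //; exact: row1_elem_ker.
Qed.

End RowAction.

Theorem proposition5p2 (p f : nat) (F : finFieldType)
    (p_prime : prime p) (p_odd : odd p) (f_gt0 : (0 < f)%N)
    (cardF : #|F| = (p ^ f)%N) :
  let sN : set (unitri F) := range (@sigma F) in
  [/\ group_closed [in sN],
      closed sN,
      infinite_index sN &
      forall U : set (unitri F), open U -> U !=set0 -> ~ (U `<=` sN)].
Proof.
split.
- split=> [|x y]; rewrite !inE; first exact: range_sigma1.
  by move=> xs ys; apply: range_sigmaM => //; apply: range_sigmaV.
- exact: closed_range_sigma.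
- exact: infinite_index_range_sigma.
- exact: range_sigma_no_open.
Qed.
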